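(* Let $N, m \geq 1$. For $k=1,\dots,N$ let $(\mathcal{A}_k,\mathcal{B}_k,\mathcal{C}_k)$ be a structured node system with $\mathcal{A}_k\in\{0,\ast,?\}^{n_k\times n_k}$, $\mathcal{B}_k\in\{0,\ast,?\}^{n_k\times 1}$, $\mathcal{C}_k\in\{0,\ast,?\}^{1\times n_k}$, such that $\mathcal{B}_k$ and $\mathcal{C}_k$ each have exactly one entry equal to $\ast$ and all other entries equal to $0$. Let $\mathcal{W}\in\{0,\ast,?\}^{N\times N}$ and $\mathcal{H}\in\{0,\ast,?\}^{N\times m}$, and let $\mathcal{A},\mathcal{B},\mathcal{C}$ be the block diagonal pattern matrices with diagonal blocks $\mathcal{A}_k$, $\mathcal{B}_k$, $\mathcal{C}_k$, respectively. Then the structured network $(\mathcal{A},\mathcal{B},\mathcal{C},\mathcal{W},\mathcal{H})$ is controllable if and only if the structured system $(\mathcal{A}+\mathcal{B}\mathcal{W}\mathcal{C},\ \mathcal{B}\mathcal{H})$ is controllable.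
   Context: A pattern matrix is a matrix with entries in the set of symbols $\{0,\ast,?\}$. For $\mathcal{M}\in\{0,\ast,?\}^{p\times q}$ its pattern class is $\mathcal{P}(\mathcal{M})=\{M\in\mathbb{R}^{p\times q} : M_{ij}=0 \text{ if } \mathcal{M}_{ij}=0,\ M_{ij}\neq 0 \text{ if } \mathcal{M}_{ij}=\ast\}$ (entries with $\mathcal{M}_{ij}=?$ are arbitrary real). Arithmetic of symbols: addition is commutative with $0+0=0$, $0+\ast=\ast$, $0+?=?$, $\ast+\ast=?$, $\ast+?=?$, $?+?=?$; multiplication is commutative with $0\cdot x=0$ for every symbol $x$, $\ast\cdot\ast=\ast$, $\ast\cdot ?=?$, $?\cdot ?=?$. Pattern matrices are added entrywise, and multiplied by $(\mathcal{M}\mathcal{N})_{ij}=\sum_{\ell}\mathcal{M}_{i\ell}\cdot\mathcal{N}_{\ell j}$. Block diagonal pattern matrices have $0$ entries outside the diagonal blocks: $\mathcal{A}=\mathrm{diag}(\mathcal{A}_1,\dots,\mathcal{A}_N)$, and similarly for $\mathcal{B}$, $\mathcal{C}$. A structured system $(\mathcal{X},\mathcal{Y})$, with $\mathcal{X}$ a square pattern matrix and $\mathcal{Y}$ a pattern matrix with the same number of rows, is called controllable (strongly structurally controllable) if for all $X\in\mathcal{P}(\mathcal{X})$ and $Y\in\mathcal{P}(\mathcal{Y})$ the linear system $\dot x=Xx+Yu$ is controllable. The structured network $(\mathcal{A},\mathcal{B},\mathcal{C},\mathcal{W},\mathcal{H})$ is called controllable if $\dot x=(A+BWC)x+BHu$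 is controllable for all $A\in\mathcal{P}(\mathcal{A})$, $B\in\mathcal{P}(\mathcal{B})$, $C\in\mathcal{P}(\mathcal{C})$, $W\in\mathcal{P}(\mathcal{W})$, $H\in\mathcal{P}(\mathcal{H})$. *)

(* Defs.v *)
From HB Require Import structures.
From mathcomp Require Import all_boot all_order all_algebra.
From mathcomp Require Import all_classical all_reals all_analysis.

Set Implicit Arguments.
Unset Strict Implicit.
Unset Printing Implicit Defensive.

Import Order.TTheory GRing.Theory Num.Theory.
Import numFieldNormedType.Exports.
Local Open Scope classical_set_scope.
Local Open Scope ring_scope.

Inductive symbol : predArgType := SZero | SStar | SAny.

Definition symbol_code (a : symbol) : option bool :=
  match a with SZero => None | SStar => Some true | SAny => Some false end.

Definition symbol_decode (b : option bool) : symbol :=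
  match b with None => SZero | Some true => SStar | Some false => SAny end.

Lemma symbol_codeK : cancel symbol_code symbol_decode.
Proof. by case. Qed.

HB.instance Definition _ := Countable.copy symbol (can_type symbol_codeK).

Definition symbol_add (a b : symbol) : symbol :=
  match a, b with
  | SZero, c | c, SZero => c
  | _, _ => SAny
  end.

Definition symbol_mul (a b : symbol) : symbol :=
  match a, b with
  | SZero, _ | _, SZero => SZero
  | SStar, SStar => SStar
  | _, _ => SAny
  end.

Lemma symbol_addA : associative symbol_add.
Proof. by do 3 case. Qed.

Lemma symbol_addC : commutative symbol_add.
Proof. by do 2 case. Qed.

Lemma symbol_add0 : left_id SZero symbol_add.
Proof. by case. Qed.

HB.instance Definition _ :=
  GRing.isNmodule.Build symbol symbol_addA symbol_addC symbol_add0.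

Lemma symbol_mulA : associative symbol_mul.
Proof. by do 3 case. Qed.

Lemma symbol_mulC : commutative symbol_mul.
Proof. by do 2 case. Qed.

Lemma symbol_mul1 : left_id SStar symbol_mul.
Proof. by case. Qed.

Lemma symbol_mulDl : left_distributive symbol_mul symbol_add.
Proof. by do 3 case. Qed.

Lemma symbol_mul0 : left_zero SZero symbol_mul.
Proof. by case. Qed.

Lemma symbol_oner_neq0 : SStar != SZero.
Proof. by []. Qed.

(* The symbols form a commutative semiring with 0 := SZero and 1 := SStar, so
   that + and *m on 'M[symbol] are the pattern matrix sum and product. *)
HB.instance Definition _ := GRing.Nmodule_isComNzSemiRing.Build symbol
  symbol_mulA symbol_mulC symbol_mul1 symbol_mulDl symbol_mul0 symbol_oner_neq0.

Definition matches (R : realType) (a : symbol) (x : R) : Prop :=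
  match a with SZero => x = 0 | SStar => x <> 0 | SAny => True end.

Definition pattern_class (R : realType) (p q : nat) (P : 'M[symbol]_(p, q)) :
    set 'M[R]_(p, q) :=
  [set M | forall i j, matches (P i j) (M i j)].

(* u is an integrable input on [0, T] and x is the corresponding (Caratheodory)
   solution of x' = X x + Y u, i.e. x solves the integrated equation. *)
Definition trajectory (R : realType) (n m : nat) (X : 'M[R]_n)
    (Y : 'M[R]_(n, m)) (T : R) (u : R -> 'cV[R]_m) (x : R -> 'cV[R]_n) : Prop :=
  [/\ forall j, (@lebesgue_measure R).-integrable `[0, T]
                  (EFin \o (fun s => u s j 0)),
      forall i, {within `[0, T], continuous (fun t => x t i 0)} &
      forall i t, 0 <= t <= T ->
        x t i 0 = x 0 i 0
          + \int[@lebesgue_measure R]_(s in `[0, t]) ((X *m x s + Y *m u s) i 0)].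

Definition controllable (R : realType) (n m : nat) (X : 'M[R]_n)
    (Y : 'M[R]_(n, m)) : Prop :=
  forall x0 x1 : 'cV[R]_n, exists T : R, exists u : R -> 'cV[R]_m,
    exists x : R -> 'cV[R]_n,
      [/\ 0 < T, trajectory X Y T u x, x 0 = x0 & x T = x1].

Definition system_controllable (R : realType) (n m : nat) (X : 'M[symbol]_n)
    (Y : 'M[symbol]_(n, m)) : Prop :=
  forall (M : 'M[R]_n) (L : 'M[R]_(n, m)),
    pattern_class X M -> pattern_class Y L -> controllable M L.

Definition network_controllable (R : realType) (n p q m : nat)
    (A : 'M[symbol]_n) (B : 'M[symbol]_(n, p)) (C : 'M[symbol]_(q, n))
    (W : 'M[symbol]_(p, q)) (H : 'M[symbol]_(p, m)) : Prop :=
  forall (A' : 'M[R]_n) (B' : 'M[R]_(n, p)) (C' : 'M[R]_(q, n))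
         (W' : 'M[R]_(p, q)) (H' : 'M[R]_(p, m)),
    pattern_class A A' -> pattern_class B B' -> pattern_class C C' ->
    pattern_class W W' -> pattern_class H H' ->
    controllable (A' + B' *m W' *m C') (B' *m H').

(* diag(B_1, ..., B_N) for column blocks and diag(C_1, ..., C_N) for row blocks.
   The library's mxdiag only takes square blocks; an mxblock with all column (or
   row) sizes 1 would have dimension \sum_(k < N) 1, not convertible to N. *)
Definition diag_cols (N : nat) (n : 'I_N -> nat)
    (B : forall k, 'cV[symbol]_(n k)) : 'M[symbol]_(\sum_k n k, N) :=
  \mxcol_k (\matrix_(i < n k, j < N) if j == k then B k i 0 else SZero).

Definition diag_rows (N : nat) (n : 'I_N -> nat)
    (C : forall k, 'rV[symbol]_(n k)) : 'M[symbol]_(N, \sum_k n k) :=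
  \mxrow_k (\matrix_(i < N, j < n k) if i == k then C k 0 j else SZero).

Definition single_star (p q : nat) (P : 'M[symbol]_(p, q)) : Prop :=
  exists i j, P i j = SStar /\
    forall i' j', (i', j') <> (i, j) -> P i' j' = SZero.

(* Main.v *)
Require Import Defs.
From mathcomp Require Import all_boot all_order all_algebra.
From mathcomp Require Import all_classical all_reals all_analysis.

(** Both notions quantify the same property, controllability of a pair of real
    matrices, over two families of pairs: the pairs
    [(A' + B' *m W' *m C', B' *m H')] with every factor in its pattern class,
    and the pairs in the pattern classes of [A + B *m W *m C] and [B *m H].
    The theorem holds because these two families of pairs coincide; nothing
    about controllability itself enters.

    One inclusion is general: symbols abstract the real operations soundly, so
    sums and products of realizations realize the pattern sums and products
    ([pattern_class_add], [pattern_class_mul]).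

    The converse fails for arbitrary products.  For instance, a column of two
    stars times a row of two stars is the 2 by 2 pattern of stars, whose class
    contains invertible matrices, whereas products of realizations have rank
    one; moreover, the two components of the pair share the factor [B'].  Here,
    however, the stars of the blocks sit in distinct rows of [B] and distinct
    columns of [C], so these patterns are selection matrices: [B] merely moves
    the rows of [W] and [H] to distinct positions, and [C] does the same with columns.  The real 0/1
    matrices with the same stars therefore serve for every realization
    ([pattern_class_selmx], [pattern_class_tr_selmx]).  The remaining sum
    [A + B *m W *m C] may overlap, but a real number matching a sum of two
    symbols always splits accordingly ([matches_add_split]): even star + star,
    which allows every value, is attained by two nonzero summands. *)

Set Implicit Arguments.
Unset Strict Implicit.
Unset Printing Implicit Defensive.

Import GRing.Theory Num.Theory.
Local Open Scope ring_scope.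

Lemma matches_add (R : realType) (a b : symbol) (x y : R) :
  matches a x -> matches b y -> matches (a + b) (x + y).
Proof. by case: a; case: b => //= hx hy; rewrite ?hx ?hy ?add0r ?addr0. Qed.

Lemma matches_mul (R : realType) (a b : symbol) (x y : R) :
  matches a x -> matches b y -> matches (a * b) (x * y).
Proof.
case: a; case: b => //= hx hy; rewrite ?hx ?hy ?mul0r ?mulr0 //.
by apply/eqP; rewrite mulf_neq0 //; apply/eqP.
Qed.

Lemma matches_natr_bool (R : realType) (c : bool) :
  matches (c%:R : symbol) (c%:R : R).
Proof. by case: c => //=; apply/eqP; rewrite oner_eq0. Qed.

(** The only delicate case is star + star: [x] must avoid both [0] and [z]. *)
Lemma matches_add_split (R : realType) (a b : symbol) (z : R) :
  matches (a + b) z ->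
  exists x y : R, [/\ matches a x, matches b y & x + y = z].
Proof.
have n10 : (1 : R) <> 0 by apply/eqP; rewrite oner_eq0.
case: a; case: b => /= hz.
- by exists 0, 0; rewrite addr0.
- by exists 0, z; rewrite add0r.
- by exists 0, z; rewrite add0r.
- by exists z, 0; rewrite addr0.
- have [->|/eqP z1] := eqVneq z 1.
    exists (- 1), (1 + 1); split; last by rewrite addKr.
      by apply/eqP; rewrite oppr_eq0 oner_eq0.
    by apply/eqP; rewrite -(natrD _ 1 1) pnatr_eq0.
  exists 1, (z - 1); split=> //; last by rewrite addrC subrK.
  by apply/eqP; rewrite subr_eq0; apply/eqP.
- by exists 1, (z - 1); rewrite addrC subrK.
- by exists z, 0; rewrite addr0.
- by exists (z - 1), 1; rewrite subrK.
- by exists z, 0; rewrite addr0.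
Qed.

Lemma pattern_class_add (R : realType) (p q : nat) (X Y : 'M[symbol]_(p, q))
    (M L : 'M[R]_(p, q)) :
  pattern_class X M -> pattern_class Y L -> pattern_class (X + Y) (M + L).
Proof. by move=> hM hL i j; rewrite !mxE; apply: matches_add. Qed.

Lemma pattern_class_mul (R : realType) (p q r : nat) (X : 'M[symbol]_(p, q))
    (Y : 'M[symbol]_(q, r)) (M : 'M[R]_(p, q)) (L : 'M[R]_(q, r)) :
  pattern_class X M -> pattern_class Y L -> pattern_class (X *m Y) (M *m L).
Proof.
move=> hM hL i j; rewrite !mxE.
elim/big_ind2: _ => // [a x b y|k _]; first exact: matches_add.
exact: matches_mul.
Qed.

Lemma pattern_class_tr (R : realType) (p q : nat) (X : 'M[symbol]_(p, q))
    (M : 'M[R]_(p, q)) :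
  pattern_class X M -> pattern_class X^T M^T.
Proof. by move=> hM i j; rewrite !mxE. Qed.

Lemma pattern_class_add_split (R : realType) (p q : nat)
    (X Y : 'M[symbol]_(p, q)) (M : 'M[R]_(p, q)) :
  pattern_class (X + Y) M ->
  exists M1 M2 : 'M[R]_(p, q),
    [/\ pattern_class X M1, pattern_class Y M2 & M1 + M2 = M].
Proof.
move=> hM.
have split_entry (ij : 'I_p * 'I_q) : exists xy : R * R,
    [/\ matches (X ij.1 ij.2) xy.1, matches (Y ij.1 ij.2) xy.2
      & xy.1 + xy.2 = M ij.1 ij.2].
  have := hM ij.1 ij.2; rewrite mxE.
  by move=> /matches_add_split[x [y hxy]]; exists (x, y).
have [f hf] := choice split_entry.
exists (\matrix_(i, j) (f (i, j)).1), (\matrix_(i, j) (f (i, j)).2); split.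
- by move=> i j; rewrite mxE; have [] := hf (i, j).
- by move=> i j; rewrite mxE; have [] := hf (i, j).
- by apply/matrixP => i j; rewrite !mxE; have [] := hf (i, j).
Qed.

(** Defined over any semiring so that the same [b] yields both a pattern and,
    over the reals, its 0/1 realization. *)
Definition selmx (S : nzSemiRingType) (p q : nat) (b : 'I_q -> 'I_p) :
  'M[S]_(p, q) := \matrix_(i, k) (i == b k)%:R.

Lemma selmx_class (R : realType) (p q : nat) (b : 'I_q -> 'I_p) :
  pattern_class (selmx symbol b) (selmx R b).
Proof. by move=> i k; rewrite !mxE; apply: matches_natr_bool. Qed.

Lemma selmx_mul_image (S : nzSemiRingType) (p q r : nat) (b : 'I_q -> 'I_p)
    (X : 'M[S]_(q, r)) (k : 'I_q) (j : 'I_r) :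
  injective b -> (selmx S b *m X) (b k) j = X k j.
Proof.
move=> b_inj; rewrite mxE (bigD1 k) //= mxE eqxx mul1r big1 ?addr0 // => l lk.
by rewrite mxE (inj_eq b_inj) eq_sym (negbTE lk) mul0r.
Qed.

Lemma selmx_mul_out (S : nzSemiRingType) (p q r : nat) (b : 'I_q -> 'I_p)
    (X : 'M[S]_(q, r)) (i : 'I_p) (j : 'I_r) :
  (forall k, i != b k) -> (selmx S b *m X) i j = 0.
Proof.
by move=> ib; rewrite mxE big1 // => k _; rewrite mxE (negbTE (ib k)) mul0r.
Qed.

(** Row [k] of [X] reappears unchanged as row [b k] of the product, so it can be
    read off there; all other rows of the product vanish. *)
Lemma pattern_class_selmx (R : realType) (p q r : nat) (b : 'I_q -> 'I_p)
    (X : 'M[symbol]_(q, r)) (M : 'M[R]_(p, r)) :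
  injective b -> pattern_class (selmx symbol b *m X) M ->
  exists2 L : 'M[R]_(q, r), pattern_class X L & M = selmx R b *m L.
Proof.
move=> b_inj hM; exists (\matrix_(k, j) M (b k) j).
  by move=> k j; have := hM (b k) j; rewrite selmx_mul_image // mxE.
apply/matrixP => i j; have [/existsP[k /eqP->]|] := boolP [exists k, i == b k].
  by rewrite selmx_mul_image // mxE.
move=> /existsPn ib; rewrite selmx_mul_out //.
by have := hM i j; rewrite selmx_mul_out.
Qed.

Lemma pattern_class_tr_selmx (R : realType) (p q r : nat) (c : 'I_q -> 'I_p)
    (X : 'M[symbol]_(r, q)) (M : 'M[R]_(r, p)) :
  injective c -> pattern_class (X *m (selmx symbol c)^T) M ->
  exists2 L : 'M[R]_(r, q), pattern_class X L & M = L *m (selmx R c)^T.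
Proof.
move=> c_inj /pattern_class_tr; rewrite trmx_mul trmxK.
move=> /(pattern_class_selmx c_inj)[L hL eqM]; exists L^T.
  by move=> i j; rewrite mxE; have := hL j i; rewrite mxE.
by rewrite -[M]trmxK eqM trmx_mul.
Qed.

(** From right to left, every network realization realizes the system patterns.
    From left to right, splitting the sum and then peeling off the selections
    turns a realization of the system patterns into one of the network, the same
    real selection matrix serving for the state matrix and the input matrix. *)
Lemma network_controllable_selmx (R : realType) (n p q m : nat)
    (b : 'I_p -> 'I_n) (c : 'I_q -> 'I_n) (A : 'M[symbol]_n)
    (W : 'M[symbol]_(p, q)) (H : 'M[symbol]_(p, m)) :
  injective b -> injective c ->
  network_controllable R A (selmx symbol b) (selmx symbol c)^T W H <->
  system_controllable R (A + selmx symbol b *m W *m (selmx symbol c)^T)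
    (selmx symbol b *m H).
Proof.
move=> b_inj c_inj; split=> ctrl.
  move=> M L /pattern_class_add_split[A' [V [hA hV <-]]].
  move=> /(pattern_class_selmx b_inj)[H' hH ->].
  move: hV => /(pattern_class_tr_selmx c_inj)[V' + ->].
  move=> /(pattern_class_selmx b_inj)[W' hW ->].
  by apply: ctrl => //; [|apply: pattern_class_tr]; apply: selmx_class.
move=> A' B' C' W' H' hA hB hC hW hH; apply: ctrl.
  by apply: pattern_class_add => //; do 2?apply: pattern_class_mul.
exact: pattern_class_mul.
Qed.

(** Different columns of the block diagonal matrix carry their stars in different
    blocks of rows, hence in different rows. *)
Lemma diag_cols_selmx (N : nat) (n : 'I_N -> nat)
    (B : forall k, 'cV[symbol]_(n k)) :
  (forall k, single_star (B k)) ->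
  exists2 b : 'I_N -> 'I_(\sum_k n k), injective b &
    diag_cols B = selmx symbol b.
Proof.
move=> hB.
have star_row k : {i : 'I_(n k) | forall i', B k i' 0 = (i' == i)%:R}.
  apply: cid; have [i [j [Bij B0]]] := hB k; exists i => i'.
  have [->|/eqP neq] := eqVneq i' i; first by move: Bij; rewrite (ord1 j).
  by apply: B0 => -[].
pose b k : 'I_(\sum_k n k) := tagnat.Rank k (sval (star_row k)).
have b_inj : injective b.
  by move=> k l /(congr1 tagnat.sig1); rewrite !tagnat.Rank1K.
exists b => //; apply/matrixP => s j; rewrite !mxE.
(* With s written as row i of block k, both sides ask that j be k and that i
   be the row of the star of that block. *)
rewrite -[s in RHS]tagnat.sig2K.
move: (tagnat.sig1 s) (tagnat.sig2 s) => k i.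
have [->|neq] := eqVneq j k.
  rewrite (svalP (star_row k)) /b; congr (nat_of_bool _)%:R.
  apply/eqP/eqP => [->//|/(congr1 tagnat.sig)].
  by rewrite /tagnat.Rank !tagnat.rankK => /eqP; rewrite eq_Tagged => /eqP.
case: eqP => // /(congr1 tagnat.sig1); rewrite !tagnat.Rank1K => kj.
by rewrite kj eqxx in neq.
Qed.

Lemma single_star_tr (p q : nat) (P : 'M[symbol]_(p, q)) :
  single_star P -> single_star P^T.
Proof.
move=> [i [j [Pij P0]]]; exists j, i; rewrite mxE; split=> // j' i' neq.
by rewrite mxE; apply: P0 => -[ii' jj']; apply: neq; rewrite ii' jj'.
Qed.

Lemma diag_rows_tr (N : nat) (n : 'I_N -> nat)
    (C : forall k, 'rV[symbol]_(n k)) :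
  diag_rows C = (diag_cols (fun k => (C k)^T))^T.
Proof. by apply/matrixP => i s; rewrite !mxE. Qed.

Theorem theorem9 (R : realType) (N m : nat) (hN : (1 <= N)%N) (hm : (1 <= m)%N)
    (n : 'I_N -> nat)
    (A : forall k : 'I_N, 'M[symbol]_(n k))
    (B : forall k : 'I_N, 'M[symbol]_(n k, 1))
    (C : forall k : 'I_N, 'M[symbol]_(1, n k))
    (hB : forall k : 'I_N, single_star (B k))
    (hC : forall k : 'I_N, single_star (C k))
    (W : 'M[symbol]_N) (H : 'M[symbol]_(N, m)) :
  network_controllable R (\mxdiag_k A k) (diag_cols B) (diag_rows C) W H <->
  system_controllable R (\mxdiag_k A k + diag_cols B *m W *m diag_rows C)
    (diag_cols B *m H).
Proof.
have [b b_inj ->] := diag_cols_selmx hB.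
have [c c_inj eqC] := diag_cols_selmx (fun k => single_star_tr (hC k)).
by rewrite diag_rows_tr eqC; apply: network_controllable_selmx.
Qed.
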